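(* Let $M=(S,\mathit{Prob},\iota_{init},AP,L)$ be a finite Markov chain, let $s\in S$, let $Q$ be a PPTL formula over $AP$, and let $G=(V,E,v_0,\Omega)$ be a deterministic $\mathit{NFG}_{\mathit{inf}}$ with Rabin acceptance condition for $Q$. Let $U\subseteq S\times V$ be the union of all accepting bottom strongly connected components of the product Markov chain $M\otimes G$. Then $$\Pr\nolimits^{M}(s\models G)=\Pr\nolimits^{M\otimes G}\big(\langle s,Q'\rangle\models\Diamond U\big),$$ where $Q'\in V$ is the node such that $(v_0,L(s),Q')\in E$. Here $\Pr^M(s\models G)$ is the probability of the set of infinite paths of $M$ starting in $s$ that are accepted by $G$, and $\Pr^{M\otimes G}(\langle s,Q'\rangle\models\Diamond U)$ is the probability of the set of infinite paths of $M\otimes G$ starting in $\langle s,Q'\rangle$ that eventually visit $U$.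
   Context: **Markov chains.** A Markov chain is a tuple $M=(S,\mathit{Prob},\iota_{init},AP,L)$ with $S$ a countable nonempty set of states, $\mathit{Prob}:S\times S\to[0,1]$ with $\sum_{s'\in S}\mathit{Prob}(s,s')=1$ for every $s$, $\iota_{init}:S\to[0,1]$ with $\sum_s\iota_{init}(s)=1$, $AP$ a finite set of atomic propositions and $L:S\to 2^{AP}$. It is finite if $S$ is finite. Infinite paths are sequences $s_0,s_1,\ldots$ with $\mathit{Prob}(s_i,s_{i+1})>0$ for all $i\ge 0$. The $\sigma$-algebra on infinite paths is generated by the cylinder sets $\mathit{Cyl}(s_0,\ldots,s_n)$ (all paths with prefix $s_0,\ldots,s_n$). For a start state $s$, the probability measure on paths starting in $s=s_0$ is the one determined by $\Pr(\mathit{Cyl}(s_0,\ldots,s_n))=\prod_{0\le i<n}\mathit{Prob}(s_i,s_{i+1})$. **PPTL.** Formulas over $AP$: $Q::=\pi\mid\neg Q\mid\bigcirc Q\mid Q_1\wedge Q_2\mid (Q_1,\ldots,Q_m)\ \mathit{prj}\ Q\mid Q^+$, with $\pi\in AP$, $m\ge1$. A state formula is one without $\bigcirc,\mathit{prj},{}^+$. An interval $\sigma=\langle s_0,s_1,\ldots\rangle$ is a nonempty finite or infinite sequence of maps $s_i:AP\to\{true,false\}$ (equivalently subsets of $AP$); $|\sigma|$ is $\omega$ if infinite, otherwise the number of states minus 1. Write $a\preceq b$ for $a\le b$ and not $a=b=\omega$. For integers $0\le r_1\le\cdots\le r_h\preceq|\sigma|$, $\sigma\downarrow(r_1,\ldots,r_h)=\langle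 s_{t_1},\ldots,s_{t_l}\rangle$, where $t_1<\cdots<t_l$ is obtained from $r_1,\ldots,r_h$ by deleting duplicates. $\sigma_{(a..b)}$ is the subinterval from index $a$ to $b$ and $\cdot$ is concatenation. Satisfaction for $(\sigma,i,k,j)$ with integers $i\le k\preceq j$, $j\in\mathbb N\cup\{\omega\}$: (1) $\models\pi$ iff $s_k(\pi)=true$; (2) $\neg,\wedge$ as usual; (3) $\models\bigcirc Q$ iff $k<j$ and $(\sigma,i,k+1,j)\models Q$; (4) $\models(Q_1,\ldots,Q_m)\ \mathit{prj}\ Q$ iff there are $k=r_0\le r_1\le\cdots\le r_m\preceq j$ with $(\sigma,i,r_0,r_1)\models Q_1$, $(\sigma,r_{l-1},r_{l-1},r_l)\models Q_l$ for $1<l\le m$, and $(\sigma',0,0,|\sigma'|)\models Q$, where either $r_m<j$ and $\sigma'=\sigma\downarrow(r_0,\ldots,r_m)\cdot\sigma_{(r_m+1..j)}$, or $r_m=j$ and $\sigma'=\sigma\downarrow(r_0,\ldots,r_h)$ for some $0\le h\le m$; (5) $\models Q^+$ iff either there are $n\ge1$ and $k=r_0\le r_1\le\cdots\le r_{n-1}\preceq r_n=j$ with $(\sigma,i,r_0,r_1)\models Q$ and $(\sigma,r_{l-1},r_{l-1},r_l)\models Q$ for $1<l\le n$, or $j=\omega$ and there are infinitely many integers $k=r_0\le r_1\le\cdots$ with $\lim r_i=\omega$, $(\sigma,i,r_0,r_1)\models Q$ and $(\sigma,r_{l-1},r_{l-1},r_l)\models Q$ for all $l>1$. $\sigma\models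 Q$ means $(\sigma,0,0,|\sigma|)\models Q$. **Deterministic $\mathit{NFG}_{\mathit{inf}}$ with Rabin condition.** $G=(V,E,v_0,\Omega)$: $V$ a finite set of nodes, $v_0\in V$ initial (corresponding to the formula $Q$), $E$ a set of directed edges $(v,q,v')$ labelled by state formulas $q$, and $\Omega=\{(E_1,F_1),\ldots,(E_k,F_k)\}$ with $E_i,F_i\subseteq V$. For $A\subseteq AP$, write $(v,A,v')\in E$ if there is an edge $(v,q,v')$ whose label $q$ is true under the assignment $A$. $G$ is deterministic if for all $v\in V$ and $A\subseteq AP$ there is exactly one $v'$ with $(v,A,v')\in E$. The run of $G$ on an infinite word $A_0A_1\ldots$ over $2^{AP}$ is the sequence $v_0,v_1,v_2,\ldots$ with $(v_i,A_i,v_{i+1})\in E$. The word is accepted if, with $\inf(\rho)$ the set of nodes occurring infinitely often in the run $\rho$, there is $(E_i,F_i)\in\Omega$ with $\inf(\rho)\cap E_i=\emptyset$ and $\inf(\rho)\cap F_i\ne\emptyset$. $G$ is ''for $Q$'' if the accepted words are exactly the infinite intervals satisfying $Q$. A path $s_0,s_1,\ldots$ of $M$ is accepted by $G$ if $L(s_0)L(s_1)\ldots$ is accepted. **Product.** $M\otimes G$ is the Markov chain with state set $S\times V$ and transition probabilities $\mathit{Prob}'(\langle s',v'\rangle,\langle s'',v''\rangle)=\mathit{Prob}(s',s'')$ if $(v',L(s''),v'')\in E$, and $0$ otherwise. A bottom strongly connected component (BSCC) is a strongly connected component of the graph of positive-probability transitions that no transition leaves. A BSCC $T$ is accepting if it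 fulfils $\Omega$: for some $i$, no $\langle s',v\rangle\in T$ has $v\in E_i$ and some $\langle s',v\rangle\in T$ has $v\in F_i$. *)

(* Defs.v *)
From HB Require Import structures.
From mathcomp Require Import all_boot all_order all_algebra.
From mathcomp Require Import all_classical all_reals all_analysis.
From mathcomp Require Import ring lra.
Set Implicit Arguments.
Unset Strict Implicit.
Unset Printing Implicit Defensive.
Import Order.TTheory GRing.Theory Num.Theory.
Import numFieldNormedType.Exports.
Local Open Scope classical_set_scope.
Local Open Scope ring_scope.

(** * Finite Markov chains *)

(* The bound [Prob s t <= 1] follows from non-negativity and the row sums, and
   likewise for [init]; non-emptiness of [state] follows from [init_sum]. *)
Record markov_chain (R : realType) (AP : finType) := MarkovChain {
  state : finType;
  Prob : state -> state -> R;
  init : state -> R;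
  label : state -> {set AP};
  Prob_ge0 : forall s t, 0 <= Prob s t;
  Prob_sum : forall s, \sum_t Prob s t = 1;
  init_ge0 : forall s, 0 <= init s;
  init_sum : \sum_s init s = 1 }.
Arguments Prob {R AP} _ _ _.
Arguments init {R AP} _ _.
Arguments label {R AP} _ _.

Record inf_path (R : realType) (AP : finType) (M : markov_chain R AP) :=
  InfPath {
    path_state :> nat -> state M;
    path_pos : forall i, 0 < Prob M (path_state i) (path_state i.+1) }.

Section PathPoint.
Context (R : realType) (AP : finType) (M : markov_chain R AP).

Definition pos_succ (s : state M) : state M :=
  odflt s [pick t | 0 < Prob M s t].

Lemma pos_succP s : 0 < Prob M s (pos_succ s).
Proof.
rewrite /pos_succ; case: pickP => [t //|no] /=.
have : \sum_t Prob M s t = 1 := Prob_sum s.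
rewrite big1 => [/esym/eqP|t _]; first by rewrite oner_eq0.
by apply/eqP; rewrite eq_le Prob_ge0 andbT leNgt no.
Qed.

Lemma inf_path_inhabited : exists p : inf_path M, True.
Proof.
have [s _|no] := pickP (fun _ : state M => true).
  have pos i : 0 < Prob M (iter i pos_succ s) (iter i.+1 pos_succ s).
    exact: pos_succP.
  by exists (InfPath pos).
have := init_sum M; rewrite big1 => [/esym/eqP|s]; first by rewrite oner_eq0.
by have := no s.
Qed.

HB.instance Definition _ := gen_eqMixin (inf_path M).
HB.instance Definition _ := gen_choiceMixin (inf_path M).
HB.instance Definition _ :=
  isPointed.Build (inf_path M) (sval (cid inf_path_inhabited)).

(* The cylinder of the finite sequence [u 0, ..., u n]; the values of [u]
   beyond [n] are irrelevant. *)
Definition Cyl (u : nat -> state M) (n : nat) : set (inf_path M) :=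
  [set p | forall i, (i <= n)%N -> p i = u i].

Definition cylinders : set (set (inf_path M)) :=
  [set C | exists u n, C = Cyl u n].

Definition path_space := g_sigma_algebraType cylinders.

(* The measure for the start state [s] lives on all infinite paths and is
   carried by those starting in [s], whence the factor [u 0 == s]. *)
Definition is_path_measure (s : state M) (P : probability path_space R) :=
  forall u n, P (Cyl u n) =
    ((u 0 == s)%:R * \prod_(i < n) Prob M (u i) (u i.+1))%:E.

End PathPoint.
Arguments cylinders {R AP} M.
Arguments path_space {R AP} M.

(** Existence of the path measure: push Lebesgue measure on [[0, 1[] forward
    along the inverse-distribution-function sampling of a path. *)
Section PathMeasure.
Context (R : realType) (AP : finType) (M : markov_chain R AP).
Local Notation S := (state M).
Implicit Types (s t : S) (y : R).

Definition cumul s t : R :=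
  \sum_(x : S | (enum_rank x < enum_rank t)%N) Prob M s x.

Definition sample s y : S :=
  odflt (pos_succ s) [pick t | cumul s t <= y < cumul s t + Prob M s t].

Definition sample_step (z : S * R) : S * R :=
  let t := sample z.1 z.2 in (t, (z.2 - cumul z.1 t) / Prob M z.1 t).

Definition sample_path s y (i : nat) : S := (iter i sample_step (s, y)).1.

Lemma sample_pos s y : 0 < Prob M s (sample s y).
Proof.
rewrite /sample; case: pickP => [t /andP[h1 h2]|_] /=; last exact: pos_succP.
by have := le_lt_trans h1 h2; rewrite ltrDl.
Qed.

Lemma sample_path_pos s y i :
  0 < Prob M (sample_path s y i) (sample_path s y i.+1).
Proof. exact: sample_pos. Qed.

Definition sampled_path s y : path_space M :=
  InfPath (sample_path_pos s (if 0 <= y < 1 then y else 0)).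

Lemma cumul_step s t t' : (enum_rank t < enum_rank t')%N ->
  cumul s t + Prob M s t <= cumul s t'.
Proof.
move=> tt'; rewrite /cumul [leRHS](bigD1 t)//= [leRHS]addrC lerD2r.
rewrite [leLHS]big_mkcond [leRHS]big_mkcond /=; apply: ler_sum => x _.
case: ifP => xt; case: ifP => //.
- by rewrite (ltn_trans xt tt') /=; case: eqP => // xE; rewrite xE ltnn in xt.
- by move=> _; exact: Prob_ge0.
Qed.

Lemma cumul_ge0 s t : 0 <= cumul s t.
Proof. by apply: sumr_ge0 => x _; exact: Prob_ge0. Qed.

Lemma cumul_le1 s t : cumul s t + Prob M s t <= 1.
Proof.
rewrite -(Prob_sum s) [leRHS](bigD1 t)//= [leRHS]addrC lerD2r /cumul.
rewrite [leLHS]big_mkcond [leRHS]big_mkcond /=; apply: ler_sum => x _.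
case: ifP => xt; case: ifP => //.
- by case: eqP => // xE; rewrite xE ltnn in xt.
- by move=> _; exact: Prob_ge0.
Qed.

Lemma cumul_uniq s t t' y : cumul s t <= y < cumul s t + Prob M s t ->
  cumul s t' <= y < cumul s t' + Prob M s t' -> t = t'.
Proof.
move=> /andP[a b] /andP[c d]; apply: enum_rank_inj; apply: val_inj => /=.
case: (ltngtP (enum_rank t) (enum_rank t')) => // /(cumul_step s) h.
- by move: (lt_le_trans b (le_trans h c)); rewrite ltxx.
- by move: (lt_le_trans d (le_trans h a)); rewrite ltxx.
Qed.

Lemma cumul_exists s y : 0 <= y < 1 ->
  exists t, cumul s t <= y < cumul s t + Prob M s t.
Proof.
move=> /andP[y0 y1]; apply/not_existsP => no.
pose c k := \sum_(x : S | (enum_rank x < k)%N) Prob M s x.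
have ck k : (k <= #|S|)%N -> c k <= y.
  elim: k => [_|k IH kS]; first by rewrite /c big_pred0.
  pose t := enum_val (Ordinal kS).
  have tk : enum_rank t = k :> nat by rewrite enum_valK.
  have ctk : cumul s t = c k by rewrite /cumul tk.
  have -> : c k.+1 = cumul s t + Prob M s t.
    rewrite /c (bigD1 t) ?tk ?ltnSn//= addrC /cumul; congr (_ + _).
    apply: eq_bigl => x; rewrite tk ltnS [in RHS]ltn_neqAle andbC; congr (_ && _).
    by rewrite -tk (inj_eq val_inj) (inj_eq enum_rank_inj).
  rewrite leNgt; apply/negP => h; apply: (no t).
  by rewrite h andbT ctk IH // ltnW.
have := ck _ (leqnn _); rewrite /c (eq_bigl xpredT) ?Prob_sum ?leNgt ?y1 //.
by move=> x; rewrite ltn_ord.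
Qed.

Lemma sampleE s t y : 0 <= y < 1 ->
  (sample s y == t) = (cumul s t <= y < cumul s t + Prob M s t).
Proof.
move=> y01; rewrite /sample; case: pickP => [x hx|no] /=.
  by apply/eqP/idP => [<-//|]; exact: cumul_uniq.
by have [x hx] := cumul_exists s y01; have := no x; rewrite hx.
Qed.

Lemma sample_path_itv (u : nat -> S) n : exists a,
  [/\ 0 <= a, a + \prod_(i < n) Prob M (u i) (u i.+1) <= 1 &
    forall y, 0 <= y < 1 ->
    (forall i, (i <= n)%N -> sample_path (u 0%N) y i = u i) <->
    a <= y < a + \prod_(i < n) Prob M (u i) (u i.+1)].
Proof.
elim: n u => [|n IH] u.
  exists 0; rewrite big_ord0 add0r; split => // y y01; split => // _ i.
  by rewrite leqn0 => /eqP ->.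
have [a [a0 a1 ha]] := IH (fun i => u i.+1).
rewrite big_ord_recl /=.
set w := \prod_(i < n) _ in a1 ha *.
set p := Prob M (u 0%N) (u 1%N).
have p0 : 0 <= p by exact: Prob_ge0.
have w0 : 0 <= w by apply: prodr_ge0 => i _; exact: Prob_ge0.
have c0 : 0 <= cumul (u 0%N) (u 1%N) by exact: cumul_ge0.
have c1 : cumul (u 0%N) (u 1%N) + p <= 1 by exact: cumul_le1.
set c := cumul (u 0%N) (u 1%N) in c0 c1 *.
exists (c + p * a); split; first by rewrite addr_ge0 ?mulr_ge0.
  by rewrite -addrA -mulrDr (le_trans _ c1)// lerD2l ler_piMr.
move=> y y01.
have shift i : sample (u 0%N) y = u 1%N ->
    sample_path (u 0%N) y i.+1 = sample_path (u 1%N) ((y - c) / p) i.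
  by move=> e; rewrite /sample_path iterSr /sample_step /= e.
split.
  move=> h; have e : sample (u 0%N) y = u 1%N by exact: (h 1%N).
  have /andP[h1 h2] : c <= y < c + p by rewrite -sampleE// e.
  have pp : 0 < p by rewrite -(ltrD2l c) addr0; exact: le_lt_trans h2.
  have y'01 : 0 <= (y - c) / p < 1.
    by rewrite divr_ge0 ?subr_ge0// ltr_pdivrMr// mul1r ltrBlDl.
  have /andP[]: a <= (y - c) / p < a + w.
    by apply/ha => // i i_n; rewrite -shift// h.
  rewrite ler_pdivlMr// ltr_pdivrMr// => h3 h4; nra.
move=> /andP[h1 h2].
have pp : 0 < p.
  rewrite lt0r p0 andbT; apply/eqP => pE; move: h1 h2; rewrite pE; lra.
have h3 : a <= (y - c) / p by rewrite ler_pdivlMr//; nra.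
have h4 : (y - c) / p < a + w by rewrite ltr_pdivrMr//; nra.
have e : sample (u 0%N) y = u 1%N.
  apply/eqP; rewrite sampleE// -/c -/p; nra.
have y'01 : 0 <= (y - c) / p < 1.
  by rewrite (le_trans a0 h3)/= (lt_le_trans h4).
by case=> [//|i] i_n; rewrite shift//; apply: (ha _ y'01).2; rewrite ?h3 ?h4.
Qed.

Lemma sampled_path_Cyl (u : nat -> S) n :
  exists a, [/\ 0 <= a, a + \prod_(i < n) Prob M (u i) (u i.+1) <= 1 &
   sampled_path (u 0%N) @^-1` Cyl u n `&` `[0, 1[%classic =
   `[a, a + \prod_(i < n) Prob M (u i) (u i.+1)[%classic].
Proof.
have [a [a0 a1 ha]] := sample_path_itv u n; exists a; split => //.
apply/seteqP; split => y /=; rewrite !in_itv /=.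
  by move=> [h y01]; apply/(ha y y01) => i i_n; have := h i i_n; rewrite /= y01.
move=> h; have y01 : 0 <= y < 1.
  by case/andP: h => h1 h2; rewrite (le_trans a0 h1) (lt_le_trans h2 a1).
by split => //= i i_n; rewrite /sampled_path /= y01; apply: (ha _ y01).2.
Qed.

Lemma measurable_sampled_path s :
  measurable_fun setT (sampled_path s : measurableTypeR R -> path_space M).
Proof.
refine (@measurability _ _ _ (path_space M) _ _ (cylinders M) erefl _).
move=> _ [_ [u [n ->]] <-]; rewrite setTI.
have [us|us] := eqVneq (u 0%N) s; last first.
  rewrite (_ : _ @^-1` _ = set0)//; apply/seteqP; split => // y /= /(_ 0%N).
  by move=> /(_ isT) /= e; move: us; rewrite -e eqxx.
rewrite -{s}us; have [a [_ _ ha]] := sampled_path_Cyl u n.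
set A := _ @^-1` _ in ha *.
rewrite -(setUIDK A `[0, 1[%classic) ha.
apply: measurableU; first exact: measurable_itv.
have [h|h] := pselect (A 0).
  rewrite (_ : A `\` _ = ~` `[0, 1[%classic)//.
    by apply: measurableC; exact: measurable_itv.
  apply/seteqP; split => y /=; rewrite in_itv /=; first by case.
  move=> /negP y01; split; last exact/negP.
  by move: h; rewrite /A /= /sampled_path lexx ltr01 /= (negbTE y01).
rewrite (_ : A `\` _ = set0)//; apply/seteqP; split => // y /=.
rewrite in_itv /= => -[hA /negP y01]; apply: h; move: hA.
by rewrite /A /= /sampled_path lexx ltr01 /= (negbTE y01).
Qed.

Section SampledMeasure.
Variable s : S.

HB.instance Definition _ := @isMeasurableFun.Build _ _ _ _
  (sampled_path s : measurableTypeR R -> path_space M)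
  (measurable_sampled_path s).

Lemma measurable_unit_itv : measurable (`[0, 1[%classic : set (measurableTypeR R)).
Proof. exact: measurable_itv. Qed.

Definition sampled_measure : set (path_space M) -> \bar R :=
  pushforward (mrestr (@lebesgue_measure R) measurable_unit_itv)
    (sampled_path s).

Let sampled_measure0 : sampled_measure set0 = 0%E.
Proof. exact: measure0. Qed.

Let sampled_measure_ge0 A : (0 <= sampled_measure A)%E.
Proof. exact: measure_ge0. Qed.

Let sampled_measure_sigma_additive : semi_sigma_additive sampled_measure.
Proof. exact: measure_semi_sigma_additive. Qed.

HB.instance Definition _ := isMeasure.Build _ _ _ sampled_measure
  sampled_measure0 sampled_measure_ge0 sampled_measure_sigma_additive.

Let sampled_measure_setT : sampled_measure setT = 1%:E.
Proof.
rewrite /sampled_measure /pushforward /mrestr preimage_setT setTI.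
by rewrite lebesgue_measure_itv /= lte_fin ltr01 oppr0 adde0.
Qed.

HB.instance Definition _ := Measure_isProbability.Build _ _ _
  sampled_measure sampled_measure_setT.

End SampledMeasure.

Lemma path_measure_exists (s : S) :
  exists P : probability (path_space M) R, is_path_measure s P.
Proof.
exists (sampled_measure s) => u n /=.
rewrite /sampled_measure /pushforward /mrestr.
have [us|us] := eqVneq (u 0%N) s; last first.
  rewrite mul0r (_ : _ @^-1` _ = set0) ?set0I ?measure0//.
  apply/seteqP; split => // y /= /(_ 0%N) /(_ isT) /= e.
  by move: us; rewrite -e eqxx.
rewrite mul1r -{s}us; have [a [_ _ ->]] := sampled_path_Cyl u n.
rewrite lebesgue_measure_itv /= lte_fin ltrDl; case: ifPn => [_|].
  by rewrite EFinD addeAC subee// add0e.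
rewrite -leNgt => w0; congr EFin; apply/eqP; rewrite eq_le w0 andbT.
by apply: prodr_ge0 => i _; exact: Prob_ge0.
Qed.

(* Cylinders are stable under intersection up to the empty set and generate the
   sigma-algebra, so [is_path_measure s] has a single inhabitant. *)
Definition Pr (s : S) : probability (path_space M) R :=
  sval (cid (path_measure_exists s)).

Lemma PrP (s : S) : is_path_measure s (Pr s).
Proof. by rewrite /Pr; case: cid. Qed.

End PathMeasure.
Arguments Pr {R AP} M s.

(** * Bottom strongly connected components *)
Section BSCC.
Context (R : realType) (AP : finType) (M : markov_chain R AP).

Definition pos_trans : rel (state M) := fun s t => 0 < Prob M s t.

(* Connecting paths may leave [T]; for the maximal [T] selected by [SCC] they
   never do. *)
Definition strongly_connected (T : {set state M}) : bool :=
  (T != finset.set0) &&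
  [forall s in T, forall t in T, connect pos_trans s t].

Definition SCC (T : {set state M}) : bool := maxset strongly_connected T.

Definition BSCC (T : {set state M}) : bool :=
  SCC T && [forall s in T, forall t, pos_trans s t ==> (t \in T)].

End BSCC.

(** * Propositional projection temporal logic *)

(* Lengths and right endpoints in [nat] extended with omega, encoded as [None].
   Left endpoints are always integers: [a] precedes [b] in the sense of
   "[a <= b] but not both are omega" forces [a] to be an integer. *)
Definition natw := option nat.

Definition lew (a : nat) (b : natw) : bool :=
  if b is Some b' then (a <= b')%N else true.

Definition ltw (a : nat) (b : natw) : bool :=
  if b is Some b' then (a < b')%N else true.

(* [Prj m Qs Q] is [(Qs 0, ..., Qs m) prj Q], a list of [m.+1 >= 1] formulas. *)
Inductive pptl (AP : Type) : Type :=
| Atom of AP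
| Neg of pptl AP
| Next of pptl AP
| And of pptl AP & pptl AP
| Prj (m : nat) of ('I_m.+1 -> pptl AP) & pptl AP
| Plus of pptl AP.

Section PPTL.
Context (AP : finType).
Implicit Types (Q : pptl AP) (A : {set AP}).

Fixpoint state_formula Q : bool :=
  match Q with
  | Atom _ => true
  | Neg Q1 => state_formula Q1
  | And Q1 Q2 => state_formula Q1 && state_formula Q2
  | Next _ | Prj _ _ _ | Plus _ => false
  end.

(* Only meaningful on state formulas. *)
Fixpoint eval A Q : bool :=
  match Q with
  | Atom p => p \in A
  | Neg Q1 => ~~ eval A Q1
  | And Q1 Q2 => eval A Q1 && eval A Q2
  | Next _ | Prj _ _ _ | Plus _ => false
  end.

(* [ilen] is the number of states minus one, or omega; the values of [ist]
   beyond [ilen] are junk. *)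
Record tinterval := TInterval { ilen : natw; ist : nat -> {set AP} }.
Implicit Types sigma tau : tinterval.

Definition infinite_interval (w : nat -> {set AP}) := TInterval None w.

(* On a sorted sequence [rs], [undup rs] is strictly increasing. *)
Definition iproj sigma (rs : seq nat) : tinterval :=
  let ts := undup rs in
  TInterval (Some (size ts).-1) (fun l => ist sigma (nth 0%N ts l)).

Definition isub sigma (a : nat) (b : natw) : tinterval :=
  TInterval (omap (fun b' => (b' - a)%N) b) (fun l => ist sigma (a + l)%N).

Definition icat sigma tau : tinterval :=
  if ilen sigma is Some p then
    TInterval (omap (fun q => (p.+1 + q)%N) (ilen tau))
      (fun l => if (l <= p)%N then ist sigma l else ist tau (l - p.+1)%N)
  else sigma.

(* The [l]-th of the subintervals cut at [r 0 <= r 1 <= ...] starts at [r l];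
   only the first one keeps the left context [i]. *)
Definition left_ctx (i : nat) (r : nat -> nat) (l : nat) : nat :=
  if l is 0%N then i else r l.

Fixpoint sat Q sigma (i k : nat) (j : natw) {struct Q} : Prop :=
  match Q with
  | Atom p => p \in ist sigma k
  | Neg Q1 => ~ sat Q1 sigma i k j
  | Next Q1 => ltw k j /\ sat Q1 sigma i k.+1 j
  | And Q1 Q2 => sat Q1 sigma i k j /\ sat Q2 sigma i k j
  | Prj m Qs Q1 => exists r : nat -> nat,
      [/\ r 0%N = k,
          forall l, (l < m.+1)%N -> (r l <= r l.+1)%N,
          lew (r m.+1) j,
          forall l : 'I_m.+1,
            sat (Qs l) sigma (left_ctx i r l) (r l) (Some (r l.+1)) &
          exists sigma' : tinterval,
            sat Q1 sigma' 0 0 (ilen sigma') /\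
            ((ltw (r m.+1) j /\
              sigma' = icat (iproj sigma (mkseq r m.+2))
                            (isub sigma (r m.+1).+1 j))
             \/
             (Some (r m.+1) = j /\
              exists2 h, (h <= m.+1)%N &
                sigma' = iproj sigma (mkseq r h.+1)))]
  | Plus Q1 =>
      (* cut points [r 0, ..., r n] followed by the last endpoint [j]; there
         are [n.+1 >= 1] pieces *)
      (exists n (r : nat -> nat),
        [/\ r 0%N = k,
            forall l, (l < n)%N -> (r l <= r l.+1)%N,
            lew (r n) j &
            forall l, (l <= n)%N ->
              sat Q1 sigma (left_ctx i r l) (r l)
                (if l == n then j else Some (r l.+1))])
      \/
      (j = None /\ exists r : nat -> nat,
        [/\ r 0%N = k,
            forall l, (r l <= r l.+1)%N,
            r @ \oo --> \oo &
            forall l, sat Q1 sigma (left_ctx i r l) (r l) (Some (r l.+1))])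
  end.

Definition models sigma Q : Prop := sat Q sigma 0 0 (ilen sigma).

End PPTL.

(** * Normal form graphs with Rabin acceptance *)

Record nfg (AP : finType) := NFG {
  node : finType;
  edge : set (node * pptl AP * node);
  edge_label : forall e, edge e -> state_formula e.1.2;
  init_node : node;
  rabin : {set ({set node} * {set node})%type} }.
Arguments edge {AP} _ _.

Section NFGTheory.
Context (AP : finType) (G : nfg AP).

Definition nfg_step (v : node G) (A : {set AP}) (v' : node G) : Prop :=
  exists2 q, edge G (v, q, v') & eval A q.

Definition deterministic : Prop :=
  forall v A, exists! v', nfg_step v A v'.

Definition is_run (w : nat -> {set AP}) (rho : nat -> node G) : Prop :=
  rho 0%N = init_node G /\ forall i, nfg_step (rho i) (w i) (rho i.+1).

Definition inf_nodes (rho : nat -> node G) : set (node G) :=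
  [set v | forall n, exists2 m, (n <= m)%N & rho m = v].

Definition accepts (w : nat -> {set AP}) : Prop :=
  exists2 rho, is_run w rho &
    exists EF : {set node G} * {set node G}, [/\ EF \in rabin G,
      inf_nodes rho `&` [set` EF.1] = set0 &
      inf_nodes rho `&` [set` EF.2] !=set0].

Definition nfg_for (Q : pptl AP) : Prop :=
  forall w, accepts w <-> models (infinite_interval w) Q.

End NFGTheory.

(** * Product of a Markov chain and a deterministic graph *)
Section Product.
Context (R : realType) (AP : finType) (M : markov_chain R AP) (G : nfg AP).
Hypothesis detG : deterministic G.

Local Notation PS := (state M * node G)%type.

Definition prod_Prob (x y : PS) : R :=
  if `[< nfg_step x.2 (label M y.1) y.2 >] then Prob M x.1 y.1 else 0.

Definition prod_init (x : PS) : R :=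
  if `[< nfg_step (init_node G) (label M x.1) x.2 >] then init M x.1 else 0.

Lemma det_sum (v : node G) A (c : R) :
  \sum_(v' : node G) (if `[< nfg_step v A v' >] then c else 0) = c.
Proof.
have [v0 [h0 u0]] := detG v A.
rewrite (bigD1 v0)//= asboolT// big1 ?addr0// => v' v'0.
by rewrite asboolF// => /u0 e; rewrite e eqxx in v'0.
Qed.

Lemma prod_Prob_ge0 x y : 0 <= prod_Prob x y.
Proof. by rewrite /prod_Prob; case: ifP => // _; exact: Prob_ge0. Qed.

Lemma prod_Prob_sum x : \sum_y prod_Prob x y = 1.
Proof.
rewrite -(pair_bigA _ (fun s v => prod_Prob x (s, v)))/=.
by under eq_bigr do rewrite /prod_Prob /= det_sum; exact: Prob_sum.
Qed.

Lemma prod_init_ge0 x : 0 <= prod_init x.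
Proof. by rewrite /prod_init; case: ifP => // _; exact: init_ge0. Qed.

Lemma prod_init_sum : \sum_x prod_init x = 1.
Proof.
rewrite -(pair_bigA _ (fun s v => prod_init (s, v)))/=.
by under eq_bigr do rewrite /prod_init /= det_sum; exact: init_sum.
Qed.

(* Initial distribution and labelling are the usual ones for the product of a
   chain with a deterministic automaton; path measures depend on neither. *)
Definition product : markov_chain R (node G) :=
  MarkovChain (fun x => finset.set1 x.2)
    prod_Prob_ge0 prod_Prob_sum prod_init_ge0 prod_init_sum.

Definition accepting (T : {set state product}) : bool :=
  [exists EF in rabin G,
    [forall x in T, x.2 \notin EF.1] && [exists x in T, x.2 \in EF.2]].

Definition accepting_BSCCs : {set state product} :=
  (\bigcup_(T : {set state product} | BSCC T && accepting T) T)%SET.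

End Product.

Section Events.
Context (R : realType) (AP : finType) (M : markov_chain R AP).

Definition accepted_paths (G : nfg AP) (s : state M) : set (path_space M) :=
  [set p : inf_path M | p 0%N = s /\ accepts G (fun i => label M (p i))].

Definition eventually_visits (s : state M) (U : {set state M}) : set (path_space M) :=
  [set p : inf_path M | p 0%N = s /\ exists i, p i \in U].

End Events.
Arguments accepted_paths {R AP} M G s.
Arguments eventually_visits {R AP} M s U.

(* Main.v *)
(** Pairing a path of [M] with the run of [G] on its labels pushes the path
    measure of [s] forward to the path measure of [(s, Q')] in the product:
    both measures agree on cylinders, which generate the sigma-algebra.  Since
    [G] is deterministic, acceptance of a path depends only on the set of
    product states that its lift visits infinitely often.  In a finite chain
    this set is almost surely a BSCC: if [y -> z] is a possible transition,
    almost no path visits [y] infinitely often and [z] only finitely often.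
    A path whose limit set is a BSCC is accepted exactly when that BSCC is
    accepting, which is the case exactly when the path ever meets an accepting
    BSCC, because BSCCs are closed. *)
Require Import Defs.
From HB Require Import structures.
From mathcomp Require Import all_boot all_order all_algebra.
From mathcomp Require Import all_classical all_reals all_analysis.
Set Implicit Arguments.
Unset Strict Implicit.
Unset Printing Implicit Defensive.
Import Order.TTheory GRing.Theory Num.Theory.
Local Open Scope classical_set_scope.
Local Open Scope ring_scope.

(** * Measurability and uniqueness of measures on path space *)

Lemma measure_eq_mod_null d (T : measurableType d) (R : realType)
    (mu : {measure set T -> \bar R}) (A B Z : set T) :
  measurable A -> measurable B -> measurable Z -> mu Z = 0%E ->
  (forall x, ~ Z x -> A x <-> B x) -> mu A = mu B.
Proof.
move=> mA mB mZ Z0 AB.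
rewrite -(measureU0 mA mZ Z0) -(measureU0 mB mZ Z0); congr (mu _).
apply/seteqP; split=> x [h|h]; try by right.
all: have [z|z] := pselect (Z x); [by right|by left; apply/(AB _ z)].
Qed.

Section PathSpace.
Context (R : realType) (AP : finType) (M : markov_chain R AP).
Local Notation S := (state M).
Implicit Types (p q : inf_path M) (x y z t : S).

(** There are finitely many words of length [n.+1] over a finite state set, so such an event is a
    finite union of cylinders. *)
Lemma prefix_determined_measurable (A : set (path_space M)) n :
  (forall p q, (forall i, (i <= n)%N -> p i = q i) -> A p -> A q) ->
  measurable A.
Proof.
move=> hA; pose I := {ffun 'I_n.+1 -> S}.
rewrite (_ : A = \bigcup_(f in [set f : I | exists2 p, A p &
    forall i : 'I_n.+1, p i = f i]) Cyl (fun i => f (inord i)) n).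
  apply: fin_bigcup_measurable; first exact: finite_finset.
  by move=> f _; apply: sub_sigma_algebra; exists (fun i => f (inord i)), n.
apply/seteqP; split=> [p Ap|p [f [q Aq qf] pf]].
  exists [ffun i : 'I_n.+1 => (p : inf_path M) i].
    by exists p => // i; rewrite ffunE.
  by move=> i i_n; rewrite ffunE inordK.
apply: hA Aq => i i_n.
by rewrite (pf i i_n) -qf inordK.
Qed.

Lemma measurable_visits i (P : S -> Prop) :
  measurable [set q : path_space M | P ((q : inf_path M) i)].
Proof.
by apply: (@prefix_determined_measurable _ i) => p q /= <-.
Qed.

(** Together with the empty set, the cylinders form a generating pi-system: two of them are disjoint
    or meet in a cylinder of the longer length. *)
Lemma path_measure_ext (m1 m2 : {measure set (path_space M) -> \bar R}) :
  (forall u n, (m1 (Cyl u n) < +oo)%E) ->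
  (forall u n, m1 (Cyl u n) = m2 (Cyl u n)) ->
  forall A, measurable A -> m1 A = m2 A.
Proof.
move=> fin m12.
have [p0 _] := inf_path_inhabited M; pose x0 := p0 0%N.
pose C : set (set (path_space M)) :=
  [set A | A = set0 \/ exists u n, A = Cyl u n].
have CE : measurable = <<s C >>.
  apply/seteqP; split.
    by apply: sub_sigma_algebra2 => A [u [n ->]]; right; exists u, n.
  apply: smallest_sub; first exact: sigma_algebra_measurable.
  move=> A [->|[u [n ->]]]; first exact: measurable0.
  by apply: sub_sigma_algebra; exists u, n.
(* The covering sequence consists of the length-zero cylinders, one per start state; indices beyond
   the enumeration repeat the one of [x0]. *)
apply: (@measure_unique _ _ _ C (fun k => Cyl (fun=> nth x0 (enum S) k) 0)).
- exact: CE.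
- move=> A B [->|[u [n ->]]]; first by left; rewrite set0I.
  move=> [->|[v [m ->]]]; first by left; rewrite setI0.
  have [[p [pu pv]]|no] := pselect (exists p, Cyl u n p /\ Cyl v m p).
    right; exists p, (maxn n m); apply/seteqP; split=> q /=.
      move=> [qu qv] i; rewrite leq_max => /orP[h|h].
        by rewrite qu// pu.
      by rewrite qv// pv.
    move=> h; split=> i hi; rewrite h ?leq_max ?hi ?orbT//.
      exact: pu.
    exact: pv.
  left; apply/seteqP; split=> // q [qu qv]; case: no; by exists q.
- by move=> k; right; eexists; eexists; reflexivity.
- apply/seteqP; split=> // p _; exists (index ((p : inf_path M) 0%N) (enum S)) => //.
  by move=> i; rewrite leqn0 => /eqP ->; rewrite nth_index// mem_enum.
- by move=> A [->|[u [n ->]]]; rewrite ?measure0.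
- by move=> k; exact: fin.
Qed.

Lemma Pr_start x : Pr M x [set q | (q : inf_path M) 0%N <> x] = 0%E.
Proof.
rewrite (_ : [set q | _] = ~` Cyl (fun=> x) 0); last first.
  apply/seteqP; split=> q /= h; first by move/(_ 0%N isT).
  by move=> e; apply: h => i; rewrite leqn0 => /eqP ->.
rewrite probability_setC; last first.
  by apply: sub_sigma_algebra; exists (fun=> x), 0%N.
rewrite (@PrP _ _ M x (fun=> x) 0) eqxx big_ord0 mulr1.
by rewrite subee.
Qed.

Lemma Pr_eq_start x (A B : set (path_space M)) :
  measurable A -> measurable B ->
  (forall q, q 0%N = x -> A q <-> B q) -> Pr M x A = Pr M x B.
Proof.
move=> mA mB AB; apply: (measure_eq_mod_null mA mB _ (Pr_start x)).
  exact: (measurable_visits 0 (fun y => y <> x)).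
by move=> q /contrapT; exact: AB.
Qed.

Definition shift p : inf_path M := InfPath (fun i => path_pos p i.+1).

Lemma iter_shiftE n p i : (iter n shift p) i = p (n + i)%N.
Proof. by elim: n p => // n IH p; rewrite iterSr IH. Qed.

End PathSpace.

(** The slack [n.+1] allows [f] to look one step ahead, as [shift] does. *)
Lemma prefix_measurable_fun (R : realType) (AP AP' : finType)
    (M : markov_chain R AP) (N : markov_chain R AP')
    (f : inf_path M -> inf_path N) :
  (forall n (p q : inf_path M), (forall i, (i <= n.+1)%N -> p i = q i) ->
    forall i, (i <= n)%N -> f p i = f q i) ->
  measurable_fun setT (f : path_space M -> path_space N).
Proof.
move=> hf.
refine (@measurability _ _ _ (path_space N) _ _ (cylinders N) erefl _).
move=> _ [_ [u [n ->]] <-]; rewrite setTI.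
apply: (@prefix_determined_measurable _ _ _ _ n.+1) => p q pq /= h i i_n.
by rewrite -(hf n p q)// h.
Qed.

(** * First-step equation and null events of recurrence *)

Section FirstStep.
Context (R : realType) (AP : finType) (M : markov_chain R AP).
Local Notation S := (state M).
Implicit Types (p q : inf_path M) (x y z t : S).

Lemma measurable_shift :
  measurable_fun setT (@shift R AP M : path_space M -> path_space M).
Proof. by apply: prefix_measurable_fun => n p q pq i i_n; exact: pq. Qed.

Lemma measurable_preshift (A : set (path_space M)) :
  measurable A -> measurable (@shift R AP M @^-1` A : set (path_space M)).
Proof.
by move=> mA; rewrite -[_ @^-1` _]setTI; exact: measurable_shift.
Qed.

(** Both sides are finite measures in [A], so cylinders suffice. There only the summand [t = u 0]
    survives, and prepending [x] to the word contributes the factor [Prob M x (u 0)]. *)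
Lemma Pr_shift x (A : set (path_space M)) : measurable A ->
  Pr M x (@shift R AP M @^-1` A) = (\sum_t (Prob M x t)%:E * Pr M t A)%E.
Proof.
pose F : {mfun path_space M >-> path_space M} :=
  HB.pack (@shift R AP M : path_space M -> path_space M)
    (isMeasurableFun.Build _ _ _ _ _ measurable_shift).
pose m1 : {measure set (path_space M) -> \bar R} := distribution (Pr M x) F.
pose e k := nth x (enum S) k.
pose m2 : {measure set (path_space M) -> \bar R} :=
  msum (fun k => mscale (NngNum (Prob_ge0 x (e k))) (Pr M (e k))) #|S|.
have m2E B : m2 B = (\sum_t (Prob M x t)%:E * Pr M t B)%E.
  rewrite /m2 /= /msum /= /mscale /=.
  by rewrite -[RHS]big_enum /= (big_nth x) big_mkord -cardE.
have m1E B : m1 B = Pr M x (@shift R AP M @^-1` B) by [].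
rewrite -m1E -m2E; apply: path_measure_ext => {A} u n.
  rewrite m1E (le_lt_trans _ (ltry 1))//; apply: probability_le1.
  by apply: measurable_preshift; apply: sub_sigma_algebra; exists u, n.
rewrite m1E m2E.
pose u' i := if i is i'.+1 then u i' else x.
(* The preimage of [Cyl u n] leaves the first state free, while [Cyl u' n.+1] fixes it to [x]; they
   differ by a null set. *)
rewrite (@Pr_eq_start _ _ _ _ _ (Cyl u' n.+1)).
- rewrite PrP eqxx mul1r big_ord_recl /= (bigD1 (u 0%N))//=.
  rewrite [X in (_ + X)%E]big1 ?adde0; first by rewrite PrP eqxx mul1r EFinM.
  by move=> t tu; rewrite PrP eq_sym (negbTE tu) mul0r mule0.
- by apply: measurable_preshift; apply: sub_sigma_algebra; exists u, n.
- by apply: sub_sigma_algebra; exists u', n.+1.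
move=> q q0; split=> /= h i i_n; last exact: (h i.+1).
by case: i i_n => [//|i]; exact: h.
Qed.

(** By the first-step equation, the preimage under [shift] of an event null from every start state
    is again null from every start state; hence the induction with [A] generalized. *)
Lemma Pr_iter_shift0 (A : set (path_space M)) n x :
  measurable A -> (forall t, Pr M t A = 0%E) ->
  measurable (iter n (@shift R AP M) @^-1` A : set (path_space M)) /\
  Pr M x (iter n (@shift R AP M) @^-1` A) = 0%E.
Proof.
move=> mA A0; elim: n => [|n IH] in A mA A0 *; first by split.
apply: (IH (@shift R AP M @^-1` A)) => [|t]; first exact: measurable_preshift.
by rewrite Pr_shift// big1// => z _; rewrite A0 mule0.
Qed.

Definition visits_io (x : S) : set (path_space M) :=
  [set q | forall n, exists2 m, (n <= m)%N & (q : inf_path M) m = x].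

Lemma measurable_visits_io x : measurable (visits_io x).
Proof.
rewrite (_ : visits_io x = \bigcap_n \bigcup_m
    [set q : path_space M | (n <= m)%N /\ (q : inf_path M) m = x]).
  apply: bigcapT_measurable => n; apply: bigcupT_measurable => m.
  exact: (measurable_visits m (fun y => (n <= m)%N /\ y = x)).
apply/seteqP; split=> q h n; first by move=> _; have [m nm qm] := h n; exists m.
by have [m _ [nm qm]] := h n I; exists m.
Qed.

Lemma measurable_visits_io_avoid y z :
  measurable (visits_io y `&` [set q | forall i, (q : inf_path M) i <> z]).
Proof.
apply: measurableI; first exact: measurable_visits_io.
rewrite (_ : [set q | _] =
    \bigcap_i [set q : path_space M | (q : inf_path M) i <> z]).
  apply: bigcapT_measurable => i.
  exact: (measurable_visits i (fun x => x <> z)).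
by apply/seteqP; split=> q h i; [move=> _|]; apply: h.
Qed.

(* Maximum principle: the probability [g x] of the event from [x] satisfies
   [g x <= \sum_t Prob x t * g t], so where [g] is maximal it is maximal at all
   successors, hence along a path of the event, hence at [y] and then at [z];
   but [g z = 0]. *)
Lemma Pr_avoid_successor0 x y z : pos_trans y z ->
  Pr M x (visits_io y `&` [set q | forall i, (q : inf_path M) i <> z]) = 0%E.
Proof.
move=> yz; set F := _ `&` _.
have mF : measurable F by exact: measurable_visits_io_avoid.
pose g t := fine (Pr M t F).
have gE t : Pr M t F = (g t)%:E by rewrite fineK// fin_num_measure.
have g0 t : 0 <= g t by apply: fine_ge0; exact: measure_ge0.
have g_sub t : g t <= \sum_u Prob M t u * g u.
  (* Recurrence of [y] and avoidance of [z] survive dropping the first state, so [F] is contained in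
     its own preimage under [shift]. *)
  rewrite -lee_fin -gE (le_trans (_ : _ <= Pr M t (@shift R AP M @^-1` F))%E)//.
    apply: le_measure; rewrite ?inE//; first exact: measurable_preshift.
    move=> q [qy qz]; split=> [n|i] /=; last exact: qz.
    have [m nm qm] := qy n.+1; exists m.-1; first by case: m nm qm.
    by case: m nm qm.
  rewrite Pr_shift// -sumEFin; apply: lee_sum => u _.
  by rewrite gE EFinM.
have [t tmax] : exists t, forall u, g u <= g t.
  by have [t _ tmax] := @arg_maxP _ _ _ x xpredT g isT; exists t => u; exact: tmax.
suff gt0 : g t = 0.
  by rewrite gE; congr EFin; apply/eqP; rewrite eq_le g0 andbT -gt0 tmax.
apply/eqP/negPn/negP => gtN0.
have step u v : g u = g t -> pos_trans u v -> g v = g t.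
  move=> gu uv; apply/eqP/negPn/negP => gv.
  have {}gv : g v < g t by rewrite lt_neqAle gv tmax.
  have := g_sub u; apply/negP; rewrite -ltNge gu.
  rewrite -[ltRHS]mul1r -(Prob_sum u) mulr_suml.
  rewrite (bigD1 v)//= [ltRHS](bigD1 v)//= ltr_leD//.
    by rewrite ltr_pM2l.
  by apply: ler_sum => w _; rewrite ler_wpM2l ?Prob_ge0// tmax.
have [[q [q0 [qy qz]]]|no] := pselect (exists q : inf_path M, q 0%N = t /\ F q).
  have gq i : g (q i) = g t.
    elim: i => [|i IH]; first by rewrite q0.
    by apply: step IH _; exact: path_pos.
  have [m _ qm] := qy 0%N.
  have gz : g z = g t by apply: (step y z) => //; rewrite -qm.
  have : g z = 0; last by move=> gz0; move: gtN0; rewrite -gz gz0 eqxx.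
  rewrite /g (@Pr_eq_start _ _ _ _ _ set0) ?measure0//.
  by move=> r r0; split=> // -[_ /(_ 0%N)].
move/eqP: gtN0; apply.
rewrite /g (@Pr_eq_start _ _ _ _ _ set0) ?measure0//.
by move=> r r0; split=> // Fr; apply: no; exists r.
Qed.

(** * The limit set of a path and its almost sure shape *)

Definition inf_states p : {set S} :=
  [set x | `[< visits_io x p >]]%SET.

Lemma inf_statesP p x : x \in inf_states p <-> visits_io x p.
Proof. by rewrite inE; split=> /asboolP. Qed.

(** The limit set takes finitely many values, and each value is a finite intersection of events
    [visits_io x] and complements of such. *)
Lemma measurable_inf_states (P : {set S} -> Prop) :
  measurable [set q : path_space M | P (inf_states q)].
Proof.
rewrite (_ : [set q | _] = \bigcup_(T in [set T | P T])
    \bigcap_x [set q : path_space M | (x \in T) = `[< visits_io x q >] ]).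
  apply: fin_bigcup_measurable => [|T _]; first exact: finite_finset.
  apply: fin_bigcap_measurable => [|x _]; first exact: finite_finset.
  have mx := measurable_visits_io x.
  case: (x \in T).
    rewrite (_ : [set q | _] = visits_io x)//.
    by apply/seteqP; split=> q h; [exact/asboolP/esym/h|rewrite /= asboolT].
  rewrite (_ : [set q | _] = ~` visits_io x); first exact: measurableC.
  by apply/seteqP; split=> q h; [exact/asboolPn/negbT/esym/h|rewrite /= asboolF].
apply/seteqP; split=> [q Pq|q [T PT qT]] /=.
  by exists (inf_states q) => // x _ /=; rewrite inE.
by rewrite (_ : inf_states q = T)//; apply/setP => x; rewrite inE qT.
Qed.

Lemma pigeonhole_io (T : finType) (f : nat -> T) (P : pred T) :
  (forall n, exists2 m, (n <= m)%N & P (f m)) ->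
  exists2 x, P x & forall n, exists2 m, (n <= m)%N & f m = x.
Proof.
move=> h; apply: contrapT => no.
have /choice[b hb] (x : T) : exists n, P x -> forall m, (n <= m)%N -> f m <> x.
  have [Px|] := boolP (P x); last by exists 0%N.
  have /existsNP[n hn] : ~ forall n, exists2 m, (n <= m)%N & f m = x.
    by move=> hx; apply: no; exists x.
  by exists n => _ m nm fm; apply: hn; exists m.
(* Beyond the largest of the bounds [b x], no value satisfying [P] can occur any more. *)
have [m bm Pm] := h (\max_x b x)%N.
by apply: (hb (f m) Pm m) => //; exact: leq_trans (leq_bigmax _) bm.
Qed.

Lemma inf_states_neq0 p : exists x, x \in inf_states p.
Proof.
have [|x _ hx] := @pigeonhole_io _ p xpredT; first by move=> n; exists n.
by exists x; apply/inf_statesP.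
Qed.

Lemma connect_path p i j : (i <= j)%N -> connect (@pos_trans R AP M) (p i) (p j).
Proof.
move=> /subnK <-; elim: (j - i)%N => // n IH.
by apply: connect_trans IH _; apply: connect1; exact: path_pos.
Qed.

Lemma closed_connect (T : {set S}) :
  (forall x t, x \in T -> pos_trans x t -> t \in T) ->
  forall x y, x \in T -> connect (@pos_trans R AP M) x y -> y \in T.
Proof.
move=> cT x y xT /connectP[r + ->]; elim: r => //= z r IH in x xT *.
by move=> /andP[xz]; apply: IH; exact: cT xz.
Qed.

Lemma BSCC_closed (T : {set S}) x t :
  BSCC T -> x \in T -> pos_trans x t -> t \in T.
Proof.
by move=> /andP[_ /forall_inP h] xT xt; have /forallP/(_ t)/implyP := h x xT; apply.
Qed.

Lemma BSCC_connect (T : {set S}) x y :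
  BSCC T -> x \in T -> y \in T -> connect (@pos_trans R AP M) x y.
Proof.
by move=> /andP[/maxsetP[/andP[_ /forall_inP h] _] _] /h/forall_inP; apply.
Qed.

(** Maximality: a strongly connected superset is reachable from a point of [T], hence contained in
    the closed set [T]. *)
Lemma BSCC_of_closed (T : {set S}) : strongly_connected T ->
  (forall x t, x \in T -> pos_trans x t -> t \in T) -> BSCC T.
Proof.
move=> scT cT; apply/andP; split; last first.
  by apply/forall_inP => x xT; apply/forallP => t; apply/implyP; exact: cT.
apply/maxsetP; split=> // T' /andP[_ /forall_inP h] TT'.
apply/eqP; rewrite finset.eqEsubset TT' andbT; apply/fintype.subsetP => y yT'.
have /andP[/set0Pn[x xT] _] := scT.
apply: (closed_connect cT xT).
by have /forall_inP := h x (fintype.subsetP TT' x xT); apply.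
Qed.

(** Once in the closed set [T] the path stays there, so its limit set lies in [T]. Being nonempty
    and closed, the limit set contains all that is reachable from it, hence [T]. *)
Lemma inf_states_BSCC p (T : {set S}) i :
  BSCC (inf_states p) -> BSCC T -> p i \in T -> inf_states p = T.
Proof.
move=> bI bT piT.
have IT x : x \in inf_states p -> x \in T.
  move=> /inf_statesP/(_ i)[m im <-].
  by apply: closed_connect piT (connect_path _ im) => y t; exact: BSCC_closed.
have [x xI] := inf_states_neq0 p.
apply/setP => y; apply/idP/idP; first exact: IT.
move=> yT; apply: (closed_connect _ xI); first by move=> ? ?; exact: BSCC_closed.
exact: (BSCC_connect bT (IT x xI) yT).
Qed.

(** The path itself connects any two of its recurrent states, so only closedness can fail. Then for
    some [y], [z], [n] with [y -> z] possible, [y] recurs and [z] is avoided from time [n] on: a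
    countable union of null events. *)
Lemma Pr_inf_states_not_BSCC x :
  Pr M x [set q | ~~ BSCC (inf_states q)] = 0%E.
Proof.
apply: measure_negligible; first exact: measurable_inf_states (fun T => ~~ BSCC T).
pose F y z : set (path_space M) :=
  visits_io y `&` [set q | forall i, (q : inf_path M) i <> z].
(* Triples [(y, z, n)] are coded by natural numbers; invalid codes and impossible transitions
   contribute the empty set. *)
pose B k : set (path_space M) :=
  if unpickle k is Some (y, z, n) then
    if pos_trans y z then iter n (@shift R AP M) @^-1` F y z else set0
  else set0.
apply: (@negligibleS _ _ _ _ (\bigcup_k B k)); last first.
  apply: negligible_bigcup => k; rewrite /B.
  case: unpickle => [[[y z] n]|]; last exact: negligible_set0.
  case: ifPn => [yz|_]; last exact: negligible_set0.
  have [mB B0] := Pr_iter_shift0 n x (measurable_visits_io_avoid y z)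
    (fun t => Pr_avoid_successor0 t yz).
  exists (iter n (@shift R AP M) @^-1` F y z); split; [exact: mB|exact: B0|by []].
move=> q /= /negP nb; apply: contrapT => nB; apply: nb.
have cl y z : y \in inf_states q -> pos_trans y z -> z \in inf_states q.
  move=> /inf_statesP yI yz; apply/inf_statesP; apply: contrapT => /existsNP[n hn].
  apply: nB; exists (pickle (y, z, n)) => //; rewrite /B pickleK yz.
  split=> [k|k] /=.
    have [m km qm] := yI (n + k)%N; exists (m - n)%N.
      by rewrite leq_subRL// (leq_trans (leq_addr _ _) km).
    by rewrite iter_shiftE subnKC// (leq_trans (leq_addr _ _) km).
  by rewrite iter_shiftE => qk; apply: hn; exists (n + k)%N => //; rewrite leq_addr.
apply: BSCC_of_closed cl; apply/andP; split.
  by apply/set0Pn; exact: inf_states_neq0.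
apply/forall_inP => y /inf_statesP/(_ 0%N)[i _ <-].
by apply/forall_inP => z /inf_statesP/(_ i)[j ij <-]; exact: connect_path.
Qed.

End FirstStep.

(** * Lifting paths of the chain to the product *)

Section Lift.
Context (R : realType) (AP : finType) (M : markov_chain R AP) (G : nfg AP).
Hypothesis detG : deterministic G.
Local Notation N := (product M detG).
Implicit Types (p : inf_path M) (v : node G) (w : nat -> {set AP}).

Definition det_next v (A : {set AP}) : node G := sval (cid (detG v A)).

Lemma det_nextP v A v' : nfg_step v A v' <-> v' = det_next v A.
Proof.
rewrite /det_next; case: cid => v1 [s1 u1] /=.
by split=> [/u1//|->].
Qed.

Fixpoint run_from v w (i : nat) : node G :=
  if i is i'.+1 then det_next (run_from v w i') (w i') else v.

Lemma is_runP w rho : is_run w rho <-> rho = run_from (init_node G) w.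
Proof.
split=> [[r0 rS]|->]; last by split=> // i; apply/det_nextP.
by apply/funext; elim=> //= i <-; exact/det_nextP.
Qed.

Lemma run_fromS v w i :
  run_from v w i.+1 = run_from (det_next v (w 0%N)) (fun j => w j.+1) i.
Proof. by elim: i => //= i ->. Qed.

(** A product transition reads the label of its target, so the run starts with the label of [p 1];
    the label of [p 0] is already accounted for in [v]. *)
Definition lift_state v p i : state N :=
  (p i, run_from v (fun j => label M (p j.+1)) i).

Lemma lift_statePE v p i :
  Prob N (lift_state v p i) (lift_state v p i.+1) = Prob M (p i) (p i.+1).
Proof. by rewrite /= /prod_Prob asboolT//; exact/det_nextP. Qed.

Lemma lift_state_pos v p i :
  0 < Prob N (lift_state v p i) (lift_state v p i.+1).
Proof. by rewrite lift_statePE path_pos. Qed.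

Definition lift_path v p : inf_path N := InfPath (lift_state_pos v p).

Lemma lift_state_prefix v p (q : inf_path M) n : (forall i, (i <= n)%N -> p i = q i) ->
  forall i, (i <= n)%N -> lift_state v p i = lift_state v q i.
Proof.
move=> pq i i_n; congr pair; first exact: pq.
elim: i i_n => //= i IH i_n; by rewrite IH ?pq// ltnW.
Qed.

Lemma measurable_lift_path v :
  measurable_fun setT (lift_path v : path_space M -> path_space N).
Proof.
apply: prefix_measurable_fun => n p q pq i i_n.
by apply: (@lift_state_prefix v p q n.+1) => //; exact: ltnW.
Qed.

(** Positivity in the product forces the node components to follow the run, so it is enough to
    extend the state components to an infinite path. *)
Lemma lift_path_extends (s : state M) v (u : nat -> state N) n :
  u 0%N = (s, v) -> (forall i, (i < n)%N -> 0 < Prob N (u i) (u i.+1)) ->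
  exists p, Cyl u n (lift_path v p).
Proof.
move=> u0 upos.
(* After time [n] the path continues by arbitrary positive successors. *)
pose r i : state M := if (i <= n)%N then (u i).1 else
  iter (i - n) (@pos_succ R AP M) (u n).1.
have posE x y : 0 < Prob N x y ->
    0 < Prob M x.1 y.1 /\ y.2 = det_next x.2 (label M y.1).
  by rewrite /= /prod_Prob; case: asboolP => [/det_nextP|]; rewrite ?ltxx.
have rpos i : 0 < Prob M (r i) (r i.+1).
  rewrite /r; case: (ltngtP i n) => i_n.
  - by have [] := posE _ _ (upos i i_n).
  - by rewrite subSn ?(ltnW i_n)//=; exact: pos_succP.
  - by rewrite i_n subSnn /=; exact: pos_succP.
exists (InfPath rpos) => i /=; elim: i => [|i IH] i_n.
  by rewrite /lift_state /= /r leq0n u0.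
have [_ e] := posE _ _ (upos i i_n).
have := IH (ltnW i_n); rewrite /lift_state => /(congr1 snd) /= e'.
have ri : r i.+1 = (u i.+1).1 by rewrite /r i_n.
by rewrite e' ri -e -surjective_pairing.
Qed.

(** On cylinders: one that contains the lift of some [p] pulls back to the cylinder of [p], with the
    same transition probabilities. One that contains no lift has a wrong start or an impossible
    transition, so both sides vanish. *)
Lemma Pr_lift (s : state M) v (A : set (path_space N)) : measurable A ->
  Pr M s (lift_path v @^-1` A) = Pr N (s, v) A.
Proof.
pose F : {mfun path_space M >-> path_space N} :=
  HB.pack (lift_path v : path_space M -> path_space N)
    (isMeasurableFun.Build _ _ _ _ _ (measurable_lift_path v)).
pose m1 : {measure set (path_space N) -> \bar R} := distribution (Pr M s) F.
have m1E B : m1 B = Pr M s (lift_path v @^-1` B) by [].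
pose m2 : {measure set (path_space N) -> \bar R} := Pr N (s, v).
have m2E B : m2 B = Pr N (s, v) B by [].
rewrite -m1E -m2E; apply: path_measure_ext => {A} u n.
  rewrite (le_lt_trans _ (ltry 1))//; apply: probability_le1.
  by apply: sub_sigma_algebra; exists u, n.
rewrite m1E m2E PrP.
have [[p hp]|no] := pselect (exists p, Cyl u n (lift_path v p)).
  rewrite (_ : _ @^-1` _ = Cyl p n).
    rewrite PrP -(hp 0%N isT) /= /lift_state /= xpair_eqE eqxx andbT.
    congr (_ * _)%:E; apply: eq_bigr => i _.
    rewrite -[in RHS](hp i (ltnW (ltn_ord i))) -[in RHS](hp i.+1 (ltn_ord i)).
    by rewrite [RHS]lift_statePE.
  apply/seteqP; split=> q h i i_n.
    have := h i i_n; rewrite -(hp i i_n) => /(congr1 fst).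
    exact.
  by rewrite -(hp i i_n); exact: (lift_state_prefix v h).
rewrite (_ : _ @^-1` _ = set0); last first.
  by apply/seteqP; split=> // p hp; apply: no; exists p.
rewrite measure0; have [u0|] := eqVneq (u 0%N) (s, v); last by rewrite mul0r.
have [/forallP pos|] := boolP [forall i : 'I_n, 0 < Prob N (u i) (u i.+1)].
  case: no; apply: (lift_path_extends u0) => i i_n.
  exact: (pos (Ordinal i_n)).
move=> /forallPn[i]; rewrite -leNgt => ui; rewrite (bigD1 i)//=.
have /eqP -> : prod_Prob (G := G) (u i) (u i.+1) == 0.
  by rewrite eq_le ui prod_Prob_ge0.
by rewrite mul0r mulr0.
Qed.

(** The run on all labels is [init_node G] followed by the node components of the lift, so the nodes
    it repeats forever are the projections of the limit set. *)
Lemma accepts_inf_states p v : nfg_step (init_node G) (label M (p 0%N)) v ->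
  accepts G (fun i => label M (p i)) <->
  accepting (inf_states (lift_path v p)).
Proof.
move=> /det_nextP vE.
set w := fun i => label M (p i).
have ioE v' : inf_nodes (run_from (init_node G) w) v' <->
    exists2 x, x \in inf_states (lift_path v p) & x.2 = v'.
  split=> [h|[x /inf_statesP h <-] n].
    have [|x /eqP xv xio] := @pigeonhole_io _ (lift_path v p)
      (fun x : state N => x.2 == v').
      (* Asking for an index at least [n.+1] skips the initial node of the run, which has no
         counterpart in the lift. *)
      move=> n; have [m nm] := h n.+1; case: m nm => // m nm.
      by rewrite run_fromS -vE => hm; exists m => //; apply/eqP.
    by exists x => //; apply/inf_statesP.
  have [m nm <-] := h n; exists m.+1; first exact: leqW.
  by rewrite run_fromS -vE.
split.
  move=> [rho /is_runP -> [EF [EFr E F]]].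
  apply/exists_inP; exists EF => //; apply/andP; split.
    apply/forall_inP => x xI; apply/negP => xE.
    have : (set0 : set (node G)) x.2; last by [].
    by rewrite -E; split=> //; apply/ioE; exists x.
  have [v' [/ioE[x xI xv] v'F]] := F.
  by apply/exists_inP; exists x => //; rewrite xv.
move=> /exists_inP[EF EFr /andP[/forall_inP hE /exists_inP[x xI xF]]].
exists (run_from (init_node G) w); first exact/is_runP.
exists EF; split=> //.
  apply/seteqP; split=> // v' [/ioE[y yI <-]] yE.
  by have := hE y yI; rewrite yE.
by exists x.2; split=> //; apply/ioE; exists x.
Qed.

End Lift.

Theorem theorem6 (R : realType) (AP : finType) (M : markov_chain R AP)
    (s : state M) (Q : pptl AP) (G : nfg AP) (detG : deterministic G)
    (G_for_Q : nfg_for G Q) (Q' : node G)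
    (Q'_step : nfg_step (init_node G) (label M s) Q') :
  Pr M s (accepted_paths M G s) =
  Pr (product M detG) (s, Q')
    (eventually_visits (product M detG) (s, Q') (accepting_BSCCs M detG)).
Proof.
set N := product M detG; set x0 : state N := (s, Q').
pose A : set (path_space N) := [set q | accepting (inf_states q)].
have mA : measurable A := measurable_inf_states (fun T => accepting T).
have mstart (x : state N) :
    measurable [set q : path_space N | (q : inf_path N) 0%N = x].
  exact: (measurable_visits 0 (fun y => y = x)).
pose AT : set (path_space N) := [set q | (q : inf_path N) 0%N = x0] `&` A.
have mAT : measurable AT by exact: measurableI.
(* This identity holds for every path; null sets enter only when [AT] is compared with reaching an
   accepting BSCC. *)
rewrite (_ : accepted_paths M G s = lift_path detG Q' @^-1` AT); last first.
  apply/seteqP; split=> p /=.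
    move=> [p0 pG]; split; first by rewrite /= /lift_state /= p0.
    by apply/accepts_inf_states => //; rewrite p0.
  move=> [/= [p0] pA]; split=> //.
  have step : nfg_step (init_node G) (label M ((p : inf_path M) 0%N)) Q'.
    by rewrite p0.
  exact/(accepts_inf_states detG step).
rewrite Pr_lift//.
apply: (measure_eq_mod_null mAT _ _ (Pr_inf_states_not_BSCC x0)).
- rewrite (_ : eventually_visits _ _ _ = [set q | (q : inf_path N) 0%N = x0] `&`
    \bigcup_i [set q : path_space N |
                (q : inf_path N) i \in accepting_BSCCs M detG]).
    apply: measurableI => //; apply: bigcupT_measurable => i.
    exact: (measurable_visits i (fun y => y \in _)).
  by apply/seteqP; split=> q [q0 [i]]; [|move=> _]; move=> qi; split=> //; exists i.
- exact: (measurable_inf_states (fun T => ~~ BSCC T)).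
move=> q /= /negP; rewrite negbK => bq; split=> -[q0].
  (* The limit set is itself an accepting BSCC, and the path visits it. *)
  move=> qA; split=> //.
  have [x xI] := inf_states_neq0 q; have /inf_statesP/(_ 0%N)[i _ qi] := xI.
  by exists i; apply/bigcupP; exists (inf_states q); rewrite ?bq ?qi.
(* Conversely, the accepting BSCC that is met must be the limit set. *)
move=> [i /bigcupP[T /andP[bT aT] qT]]; split=> //.
by rewrite /A /= (inf_states_BSCC bq bT qT).
Qed.
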